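(* Let $G$ be a word hyperbolic group, with a given finite generating set $S$. Then there exists a computable constant $K>0$ such that for any infinite order element $g$ of $G$, $[[g]]\geq K$.
   Context: Let $G$ be a group with finite generating set $S$. For $g\in G$, $|g|$ denotes the word length of $g$, i.e. the minimal length of a word on $S\cup S^{-1}$ representing $g$. For an element $g\in G$ of infinite order, the stable norm of $g$ (with respect to $S$) is $$[[g]]=\lim_{n\to+\infty}\frac{|g^n|}{n};$$ the limit exists because the sequence $(|g^n|)_n$ is sub-additive. A group $G$ with finite generating set $S$ is word hyperbolic if its Cayley graph with respect to $S$, with the path metric in which edges have length 1, is $\delta$-hyperbolic for some $\delta\geq 0$ (each side of every geodesic triangle lies in the $\delta$-neighbourhood of the union of the other two sides). *)

(* Defs.v *)
From HB Require Import structures.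
From mathcomp Require Import all_boot all_order all_algebra.
From mathcomp Require Import finmap.
From mathcomp Require Import all_classical all_reals all_analysis.
Set Implicit Arguments.
Unset Strict Implicit.
Unset Printing Implicit Defensive.
Import Order.TTheory GRing.Theory Num.Theory.
Import numFieldNormedType.Exports.
Local Open Scope classical_set_scope.
Local Open Scope ring_scope.

Section WordLength.
Variables (G : groupType) (S : {fset G}).

(* [w] is a word on the alphabet S `|` S^-1 *)
Definition is_word (w : seq G) : Prop :=
  all (fun x => (x \in S) || (x^-1 \in S)%g) w.

Definition represents (w : seq G) (g : G) : Prop :=
  is_word w /\ (\prod_(x <- w) x)%g = g.

Definition generates : Prop := forall g, exists w, represents w g.

Definition has_word_of_size (g : G) (n : nat) : bool :=
  `[< exists w, represents w g /\ size w = n >].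

(* The default 0 is used only for elements outside the subgroup generated
   by [S], hence never when [generates] holds. *)
Definition word_length (g : G) : nat :=
  if pselect (exists n, has_word_of_size g n) is left e then ex_minn e else 0%N.

End WordLength.

Definition infinite_order (G : groupType) (g : G) : Prop :=
  forall n, (0 < n)%N -> (g ^+ n)%g <> 1%g.

Definition stable_norm (R : realType) (G : groupType) (S : {fset G}) (g : G) : R :=
  limn (fun n : nat => (word_length S (g ^+ n)%g)%:R / n%:R : R).

(* [d] is meant to be a pseudometric: several terms of [X] may stand for the
   same point, which changes neither geodesics nor neighbourhoods. *)
Section SlimTriangles.
Variables (R : realType) (X : Type) (d : X -> X -> R).

Definition geodesic_segment (p q : X) (A : set X) : Prop :=
  exists (L : R) (c : R -> X),
    [/\ 0 <= L, c 0 = p, c L = q,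
        (forall s t, 0 <= s <= L -> 0 <= t <= L -> d (c s) (c t) = `|s - t|)
      & A = [set c s | s in [set s : R | 0 <= s <= L]]].

Definition neighbourhood (delta : R) (A : set X) : set X :=
  [set x | exists2 a, A a & d x a <= delta].

Definition delta_hyperbolic (delta : R) : Prop :=
  forall (p q r : X) (A B C : set X),
    geodesic_segment p q A -> geodesic_segment q r B -> geodesic_segment r p C ->
    [/\ A `<=` neighbourhood delta (B `|` C),
        B `<=` neighbourhood delta (C `|` A)
      & C `<=` neighbourhood delta (A `|` B)].

End SlimTriangles.

(* Geometric realization of the (right) Cayley graph, taken as a simple
   undirected graph: x and y are adjacent iff x^-1 * y has word length 1.
   The triple (x, y, t) is the point at distance t from x on the edge [x, y];
   (x, x, t) is the vertex x for every t. *)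
Record cayley_graph (R : realType) (G : groupType) (S : {fset G}) := CayleyPoint {
  cp_src : G;
  cp_tgt : G;
  cp_pos : R;
  cp_edge : (word_length S (cp_src^-1 * cp_tgt)%g <= 1)%N;
  cp_pos01 : 0 <= cp_pos <= 1 }.

Section CayleyMetric.
Variables (R : realType) (G : groupType) (S : {fset G}).
Implicit Types p q : cayley_graph R S.

Definition cp_end (b : bool) p : G := if b then cp_tgt p else cp_src p.

(* 1 on a genuine edge, 0 on a degenerate one *)
Definition cp_len p : R := (word_length S ((cp_src p)^-1 * cp_tgt p)%g)%:R.

Definition cp_to_end (b : bool) p : R :=
  (if b then 1 - cp_pos p else cp_pos p) * cp_len p.

(* length of a shortest path from p to q through the ends b of p and b' of q *)
Definition dist_via (b b' : bool) p q : R :=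
  cp_to_end b p + (word_length S ((cp_end b p)^-1 * cp_end b' q)%g)%:R
  + cp_to_end b' q.

(* Path metric: points of one edge are joined by a subsegment of it, possibly
   with opposite parametrizations; otherwise a path leaves the edge of p and
   enters that of q through end points. *)
Definition cayley_dist p q : R :=
  if (cp_src p == cp_src q) && (cp_tgt p == cp_tgt q)
  then `|cp_pos p - cp_pos q| * cp_len p
  else if (cp_src p == cp_tgt q) && (cp_tgt p == cp_src q)
  then `|cp_pos p - (1 - cp_pos q)| * cp_len p
  else Num.min (Num.min (dist_via false false p q) (dist_via false true p q))
               (Num.min (dist_via true false p q) (dist_via true true p q)).

End CayleyMetric.

Definition cayley_hyperbolic (R : realType) (G : groupType) (S : {fset G})
    (delta : R) : Prop :=
  delta_hyperbolic (@cayley_dist R G S) delta.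

(* Total recursive functions (Kleene), with minimization restricted to
   everywhere successful searches; [rec_prec] and [rec_mu] take the defined
   function [h] together with its defining equations. *)
Local Open Scope nat_scope.

Inductive recursive : forall n, (n.-tuple nat -> nat) -> Prop :=
| rec_zero n : recursive (fun _ : n.-tuple nat => 0)
| rec_succ : recursive (fun v : 1.-tuple nat => (thead v).+1)
| rec_proj n (i : 'I_n) : recursive (fun v : n.-tuple nat => tnth v i)
| rec_comp n m (f : m.-tuple nat -> nat) (g : 'I_m -> n.-tuple nat -> nat) :
    recursive f -> (forall i, recursive (g i)) ->
    recursive (fun v : n.-tuple nat => f [tuple g i v | i < m])
| rec_prec n (f : n.-tuple nat -> nat) (g : n.+2.-tuple nat -> nat)
    (h : n.+1.-tuple nat -> nat) :
    recursive f -> recursive g ->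
    (forall v : n.-tuple nat, h [tuple of 0 :: v] = f v) ->
    (forall k (v : n.-tuple nat),
       h [tuple of k.+1 :: v] = g [tuple of k :: h [tuple of k :: v] :: v]) ->
    recursive h
| rec_mu n (f : n.+1.-tuple nat -> nat) (h : n.-tuple nat -> nat) :
    recursive f ->
    (forall v : n.-tuple nat, f [tuple of h v :: v] = 0 /\
       forall k, k < h v -> f [tuple of k :: v] <> 0) ->
    recursive h.

Definition recursive2 (f : nat -> nat -> nat) : Prop :=
  recursive (fun v : 2.-tuple nat => f (tnth v ord0) (tnth v ord_max)).

Definition computable_rat2 (K : nat -> nat -> rat) : Prop :=
  [/\ recursive2 (fun m n => (K m n < 0)%R : nat),
      recursive2 (fun m n => `|numq (K m n)|%N)
    & recursive2 (fun m n => `|denq (K m n)|%N)].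

(* Main.v *)
(* Write d(x, y) for the word metric. Slim triangles give the four-point
   inequality d(x, y) + d(z, t) <= max(d(x, z) + d(y, t), d(x, t) + d(y, z)) + e
   with e = 4 (delta + 1). If some power h = g^k with k <= N satisfies
   |h^2| > |h| + e, the four-point inequality on 1, h^n, h^(n-1), h^(n+1) makes
   |h^n| strictly increasing, so [[g]] >= 1/k >= 1/N. Otherwise
   |g^(i+j)| <= max(|g^j| + e, |g^(j-i)|) + e for i <= j <= N, so the maximum of
   |g^k| over k <= 2N exceeds the maximum over k <= N by at most 2e, and the
   midpoint c of a longest segment [1, g^k] is moved by at most r = 4e + 2 by
   every g^j with j <= N. As r does not depend on N, taking for N a bound on the
   number of elements of length at most r yields g^i = g^j for some i < j, which
   is excluded when g has infinite order. *)
Require Import Defs.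
From HB Require Import structures.
From mathcomp Require Import all_boot all_order all_algebra.
From mathcomp Require Import finmap.
From mathcomp Require Import all_classical all_reals all_analysis.
From mathcomp Require Import zify ring lra.
Set Implicit Arguments.
Unset Strict Implicit.
Unset Printing Implicit Defensive.
Import Order.TTheory GRing.Theory Num.Theory.
Import numFieldNormedType.Exports.
Local Open Scope ring_scope.

(** * Word metric and discrete geodesics *)

Section WordMetric.
Variables (G : groupType) (S : {fset G}).
Local Open Scope group_scope.
Implicit Types (g h x y z : G) (w : seq G) (f : nat -> G).

Lemma is_word_cat w1 w2 :
  is_word S (w1 ++ w2) <-> is_word S w1 /\ is_word S w2.
Proof. by rewrite /is_word all_cat; split => /andP. Qed.

Lemma is_word_rev_inv w : is_word S w -> is_word S (rev ([seq x^-1 | x <- w])).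
Proof.
rewrite /is_word all_rev all_map => /allP sw; apply/allP => x /sw /=.
by rewrite invgK orbC.
Qed.

Lemma word_length_le_size w : is_word S w -> (word_length S (\prod_(x <- w) x) <= size w)%N.
Proof.
move=> sw; rewrite /word_length; case: pselect => // e.
by case: ex_minnP => n _; apply; apply/asboolP; exists w.
Qed.

Lemma word_length1 : word_length S 1 = 0%N.
Proof.
by apply/eqP; rewrite -leqn0; have := @word_length_le_size [::] isT; rewrite big_nil.
Qed.

Hypothesis genS : generates S.

Lemma geodesic_word g :
  exists w, [/\ is_word S w, \prod_(x <- w) x = g & size w = word_length S g].
Proof.
rewrite /word_length; case: pselect => [e|[]].
  by case: ex_minnP => n /asboolP[w [[sw wg] sz]] _; exists w.
by have [w rw] := genS g; exists (size w); apply/asboolP; exists w.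
Qed.

Lemma word_lengthM g h : (word_length S (g * h) <= word_length S g + word_length S h)%N.
Proof.
have [w [sw wg <-]] := geodesic_word g.
have [v [sv vh <-]] := geodesic_word h.
rewrite -wg -vh -big_cat -size_cat.
by apply/word_length_le_size/is_word_cat.
Qed.

Lemma word_lengthV g : word_length S g^-1 = word_length S g.
Proof.
suff le h : (word_length S h^-1 <= word_length S h)%N.
  by apply/eqP; rewrite eqn_leq le -{1}[g]invgK le.
have [w [sw wh <-]] := geodesic_word h.
have -> : h^-1 = \prod_(x <- rev [seq x^-1 | x <- w]) x.
  by rewrite -wh -{1}[w]revK -prodgV -map_rev big_map.
rewrite -(size_map (fun x : G => x^-1)) -size_rev.
exact/word_length_le_size/is_word_rev_inv.
Qed.

Definition word_dist x y := word_length S (x^-1 * y).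
Local Notation dist := word_dist.

Lemma word_dist_le_add x y z : (dist x z <= dist x y + dist y z)%N.
Proof.
by rewrite /dist (_ : x^-1 * z = (x^-1 * y) * (y^-1 * z)) ?word_lengthM// -mulgA mulVKg.
Qed.

Lemma word_distC x y : dist x y = dist y x.
Proof. by rewrite /dist -word_lengthV invgM invgK. Qed.

Lemma word_distxx x : dist x x = 0%N.
Proof. by rewrite /dist mulVg word_length1. Qed.

Lemma word_dist_mul g x y : dist (g * x) (g * y) = dist x y.
Proof. by rewrite /dist invgM -mulgA mulKg. Qed.

Lemma word_dist1g g : dist 1 g = word_length S g.
Proof. by rewrite /dist invg1 mul1g. Qed.

Lemma word_dist_exp g (m n : nat) : (m <= n)%N ->
  dist (g ^+ m) (g ^+ n) = word_length S (g ^+ (n - m)).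
Proof. by move=> le_mn; rewrite -{1}(subnKC le_mn) expgnDr /dist mulKg. Qed.

Lemma word_length_exp g (n : nat) : (word_length S (g ^+ n) <= n * word_length S g)%N.
Proof.
elim: n => [|n IHn]; first by rewrite expg0 word_length1.
rewrite expgS (leq_trans (word_lengthM _ _)) // mulSn leq_add2l //.
Qed.

(* Beyond the index [n] the path only has to be 1-Lipschitz. *)
Definition geodesic_path f (n : nat) : Prop :=
  (forall i, dist (f i) (f i.+1) <= 1)%N /\
  (forall i j, (i <= j <= n)%N -> dist (f i) (f j) = (j - i)%N).

(** The vertices are [x] times the prefix products of a shortest word for [x^-1 * y]; the path rests
    at [y] once the word is exhausted. *)
Lemma exists_geodesic_path x y :
  exists f, [/\ f 0%N = x, f (dist x y) = y & geodesic_path f (dist x y)].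
Proof.
have [w [sw wg szw]] := geodesic_word (x^-1 * y).
pose f i := x * \prod_(a <- take i w) a.
have f0 : f 0%N = x by rewrite /f take0 big_nil mulg1.
have fn : f (dist x y) = y by rewrite /f /dist -szw take_size wg mulVKg.
have lip i k : (dist (f i) (f (i + k)%N) <= k)%N.
  rewrite /f word_dist_mul takeD big_cat /= /dist mulKg.
  apply: leq_trans (word_length_le_size _) _; last by rewrite size_take_min geq_minl.
  move: sw; rewrite -{1}(cat_take_drop i w) => /is_word_cat[_].
  by rewrite -{1}(cat_take_drop k (drop i w)) => /is_word_cat[].
exists f; split=> //; split => [i|i j /andP[ij jn]]; first by rewrite -addn1.
(* The Lipschitz bounds on the three pieces cut by [i] and [j] add up to [dist x y], so each of them
   is attained. *)
have := lip i (j - i)%N; rewrite subnKC // => le1.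
have := lip 0%N i; have := lip j (dist x y - j)%N.
rewrite add0n subnKC // f0 fn.
have := word_dist_le_add x (f i) y; have := word_dist_le_add (f i) (f j) y.
by lia.
Qed.

End WordMetric.

(** * Four-point inequality and lengths of powers *)

Section SlimWordMetric.
Variables (G : groupType) (S : {fset G}).
Hypothesis genS : generates S.
Local Open Scope group_scope.
Local Notation dist := (word_dist S).
Implicit Types (g h x y z : G) (f : nat -> G).

(** Lying on one of the other two sides is expressed by equality in the triangle inequality, so only
    one side has to be given as a path. *)
Definition slim_paths (d : nat) : Prop :=
  forall f n z k, geodesic_path S f n -> (k <= n)%N ->
  (exists2 p, (dist (f 0%N) p + dist p z = dist (f 0%N) z)%N & (dist (f k) p <= d)%N) \/
  (exists2 p, (dist z p + dist p (f n) = dist z (f n))%N & (dist (f k) p <= d)%N).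

(** Gromov's four-point condition; [e] is twice the usual constant for Gromov products. *)
Definition four_point (e : nat) : Prop :=
  forall x y z t,
  (dist x y + dist z t <= maxn (dist x z + dist y t) (dist x t + dist y z) + e)%N.

(* The last point of the path that is close to the side [f 0, z] is also close
   to the side [z, f n]. *)
Lemma slim_paths_pivot d f n z : slim_paths d -> geodesic_path S f n ->
  exists k, [/\ (k <= n)%N,
    (dist (f 0%N) (f k) + dist (f k) z <= dist (f 0%N) z + d.+1.*2)%N &
    (dist (f k) (f n) + dist (f k) z <= dist z (f n) + d.+1.*2)%N].
Proof.
move=> slim gf.
pose near k := (k <= n)%N && `[< exists2 p,
  (dist (f 0%N) p + dist p z = dist (f 0%N) z)%N & (dist (f k) p <= d)%N >].
have near0 : near 0%N.
  apply/asboolP; exists (f 0%N); by rewrite word_distxx.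
have bnd k : near k -> (k <= n)%N by case/andP.
case: (ex_maxnP (ex_intro _ 0%N near0) bnd) => k /andP[kn /asboolP[p pz kp]] kmax.
(* If [k < n], maximality makes [f k.+1] close to the second side, and the edge back to [f k] costs
   one more; if [k = n], the end [f n] lies on that side. *)
have [q qz kq] : exists2 q, (dist z q + dist q (f n) = dist z (f n))%N &
                            (dist (f k) q <= d.+1)%N.
  have [kn'|nk] := ltnP k n.
    have [nr|[q qz kq]] := slim f n z k.+1 gf kn'.
      by have := kmax k.+1; rewrite /near kn' asboolT // ltnn => /(_ isT).
    exists q => //; have := word_dist_le_add genS (f k) (f k.+1) q.
    by have := gf.1 k; lia.
  have -> : k = n by lia.
  by exists (f n); rewrite word_distxx ?addn0.
have := word_dist_le_add genS (f 0%N) p (f k); have := word_dist_le_add genS (f k) p z.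
have := word_dist_le_add genS (f k) q (f n); have := word_dist_le_add genS (f k) q z.
rewrite (word_distC genS p (f k)) (word_distC genS q z).
by exists k; split => //; lia.
Qed.

(** Take pivots of [z] and [t] on a geodesic from [x] to [y]. Their order decides which pairing
    bounds the left side, and each pivot contributes [2 * d.+1]. *)
Lemma slim_paths_four_point d : slim_paths d -> four_point (4 * d.+1).
Proof.
move=> slim x y z t.
have [f [f0 fn gf]] := exists_geodesic_path genS x y.
have [i [ile iz zi]] := slim_paths_pivot z slim gf.
have [j [jle jt tj]] := slim_paths_pivot t slim gf.
rewrite !(f0, fn) in iz zi jt tj.
have := gf.2 0%N i; have := gf.2 0%N j; have := gf.2 i (dist x y).
have := gf.2 j (dist x y); have := gf.2 i j; have := gf.2 j i.
rewrite !(f0, fn).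
have := word_dist_le_add genS z (f i) t; have := word_dist_le_add genS (f i) (f j) t.
rewrite (word_distC genS z (f i)) (word_distC genS (f j) (f i)).
rewrite (word_distC genS y z) (word_distC genS y t).
by case: (leqP i j) => ij; lia.
Qed.

Variable e : nat.
Hypothesis hyp : four_point e.

Lemma word_length_exp_ge h (n : nat) :
  (word_length S h + e < word_length S (h ^+ 2))%N ->
  (n <= word_length S (h ^+ n))%N.
Proof.
move=> h2.
have incr k : (word_length S (h ^+ k) < word_length S (h ^+ k.+1))%N.
  elim: k => [|k IHk].
    (* [|h| + e < |h^2| <= 2|h|] forces [|h| > 0]. *)
    by have := word_length_exp genS h 2; rewrite expg0 expg1 word_length1; lia.
  (* The induction hypothesis rules out the term of the maximum with [|h^k|]; the other one gives
     the growth. *)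
  have := hyp 1 (h ^+ k.+1) (h ^+ k) (h ^+ k.+2).
  rewrite (word_distC genS (h ^+ k.+1) (h ^+ k)).
  rewrite !word_dist_exp ?word_dist1g ?(leqW (leqnSn _)) ?leqnSn //.
  rewrite (_ : k.+2 - k = 2)%N 1?(_ : k.+2 - k.+1 = 1)%N 1?(_ : k.+1 - k = 1)%N; try lia.
  by rewrite expg1; lia.
by elim: n => [|n IHn]; [exact: leq0n|exact: leq_ltn_trans IHn (incr n)].
Qed.

Section SlowSquares.
Variables (g : G) (N : nat).
Hypothesis slow : forall k, (k <= N)%N ->
  (word_length S (g ^+ k.*2) <= word_length S (g ^+ k) + e)%N.

Lemma word_length_exp_double (D n : nat) :
  (forall k, (k <= N)%N -> (word_length S (g ^+ k) <= D)%N) ->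
  (n <= N.*2)%N -> (word_length S (g ^+ n) <= D + e.*2)%N.
Proof.
move=> leD nN; pose i := n./2; pose j := (n - n./2)%N.
have iN : (i <= N)%N by rewrite /i; lia.
have jN : (j <= N)%N by rewrite /j; lia.
have jiN : (j - i <= N)%N by rewrite /j; lia.
(* [|g^i|] on the left absorbs the [|g^(2i)| <= |g^i| + e] given by [slow], leaving only powers with
   exponent at most [N]. *)
have := hyp 1 (g ^+ n) (g ^+ i) (g ^+ i.*2).
rewrite (word_distC genS (g ^+ n) (g ^+ i)) (word_distC genS (g ^+ n) (g ^+ i.*2)).
rewrite !word_dist_exp ?word_dist1g; try (rewrite /i; lia).
rewrite (_ : n - i.*2 = j - i)%N 1?(_ : n - i = j)%N 1?(_ : i.*2 - i = i)%N;
  try (rewrite /j /i; lia).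
by have := slow iN; have := leD _ iN; have := leD _ jN; have := leD _ jiN; lia.
Qed.

(* The midpoint of a longest segment [1, g^k] with k <= N is a quasi-center of
   the orbit of 1, so g^j can only move it a bounded amount. *)
Lemma quasi_fixed_point :
  exists c, forall j, (j <= N)%N -> (dist c (g ^+ j * c) <= 4 * e + 2)%N.
Proof.
pose k0 := [arg max_(i > ord0 : 'I_N.+1) word_length S (g ^+ i)].
have k0N : (k0 <= N)%N by rewrite -ltnS.
set D := word_length S (g ^+ k0).
have leD k : (k <= N)%N -> (word_length S (g ^+ k) <= D)%N.
  by move=> kN; rewrite /D /k0; case: arg_maxnP => // i _ /(_ (Ordinal (kN : k < N.+1)%N)); apply.
have leD2 := word_length_exp_double leD.
have [f [f0 fn gf]] := exists_geodesic_path genS 1 (g ^+ k0).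
rewrite word_dist1g -/D in fn gf.
pose c := f D./2.
have c1 : dist 1 c = D./2.
  by rewrite -f0 gf.2 ?subn0 //; lia.
have ck0 : dist c (g ^+ k0) = (D - D./2)%N by rewrite -fn gf.2 //; lia.
exists c => j jN.
have d1 : dist 1 (g ^+ k0) = D by rewrite word_dist1g.
have dj : dist (g ^+ j) (g ^+ (j + k0)) = D.
  by rewrite word_dist_exp ?leq_addr // addKn.
have ljc : dist (g ^+ j) (g ^+ j * c) = D./2.
  by rewrite -[X in dist X _]mulg1 word_dist_mul.
have rjc : dist (g ^+ j * c) (g ^+ (j + k0)) = (D - D./2)%N.
  by rewrite expgnDr word_dist_mul.
have jk0 : (dist (g ^+ k0) (g ^+ j) <= D)%N.
  case: (leqP k0 j) => le; last rewrite (word_distC genS);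
  by rewrite word_dist_exp ?leD //; lia.
have k0jk0 : (dist (g ^+ k0) (g ^+ (j + k0)) <= D)%N.
  by rewrite word_dist_exp ?leq_addl // addnK leD.
have jk01 : (dist 1%g (g ^+ (j + k0)%N) <= D + e.*2)%N.
  by rewrite word_dist1g leD2 //; lia.
have j1 : (dist 1%g (g ^+ j) <= D)%N by rewrite word_dist1g leD.
(* Up to rounding, the first two instances put [g ^+ j * c] within [D/2 + 3e] of both [1] and
   [g ^+ k0]. The third compares it with the midpoint [c] of these and adds [e]; the [+ 2] absorbs
   the rounding of [D./2]. *)
have := hyp 1 (g ^+ j * c) (g ^+ j) (g ^+ (j + k0)).
have := hyp (g ^+ k0) (g ^+ j * c) (g ^+ j) (g ^+ (j + k0)).
have := hyp c (g ^+ j * c) 1 (g ^+ k0).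
rewrite !(word_distC genS (g ^+ j * c) (g ^+ j)) ?(word_distC genS c 1).
rewrite (word_distC genS (g ^+ j * c) 1) (word_distC genS (g ^+ j * c) (g ^+ k0)).
by lia.
Qed.

End SlowSquares.

End SlimWordMetric.

(** * Counting elements of bounded length *)

Section Ball.
Variables (G : groupType) (S : {fset G}).
Hypothesis genS : generates S.
Local Open Scope group_scope.

(** The letter [1] pads short words, so that products of exactly [r] letters fill the whole ball of
    radius [r]. *)
Definition word_letters : seq G := 1 :: S ++ [seq x^-1 | x <- S].

Fixpoint word_ball (r : nat) : seq G :=
  if r is r'.+1 then [seq x * y | x <- word_letters, y <- word_ball r'] else [:: 1].

Lemma size_word_ball (r : nat) : size (word_ball r) = ((#|` S|%fset).*2.+1 ^ r)%N.
Proof.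
elim: r => // r IHr.
rewrite [word_ball _]/(allpairs *%g word_letters (word_ball r)) size_allpairs IHr.
rewrite expnS; congr (_ * _)%N.
by rewrite /= size_cat size_map addnn.
Qed.

Lemma mem_word_ballM x y (r : nat) :
  x \in word_letters -> y \in word_ball r -> x * y \in word_ball r.+1.
Proof. exact: (allpairs_f *%g). Qed.

Lemma mem_word_ball g (r : nat) : (word_length S g <= r)%N -> g \in word_ball r.
Proof.
have [w [sw <- <-]] := geodesic_word genS g.
elim: r w sw {g} => [|r IHr] [|x w].
- by rewrite big_nil mem_seq1 eqxx.
- by [].
- move=> _ _; rewrite -[X in X \in _]mul1g big_nil.
  by apply: mem_word_ballM; [rewrite mem_head|rewrite -(big_nil 1 *%g xpredT id) IHr].
move=> /andP[sx sw] wr; rewrite big_cons; apply: mem_word_ballM; last exact: IHr.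
rewrite in_cons mem_cat; apply/orP; right; case/orP: sx => sx; apply/orP; first by left.
by right; apply/mapP; exists x^-1; rewrite ?invgK.
Qed.

(** Pigeonhole: the [N + 1] conjugates [c^-1 * g^j * c] lie in a ball with at most [N] elements. *)
Lemma quasi_fixed_point_torsion g c (r N : nat) :
  ((#|` S|%fset).*2.+1 ^ r <= N)%N ->
  (forall j, (j <= N)%N -> (word_dist S c (g ^+ j * c) <= r)%N) ->
  ~ infinite_order g.
Proof.
move=> leN near inf_g.
pose s := [seq c^-1 * (g ^+ j * c) | j <- iota 0 N.+1].
have inj : injective (fun j : nat => g ^+ j).
  have wlog_lt i j : (i < j)%N -> g ^+ i <> g ^+ j.
    move=> ij; rewrite -(subnKC (ltnW ij)) expgnDr -[LHS]mulg1 => /mulgI.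
    by move/esym; apply: inf_g; rewrite subn_gt0.
  by move=> i j; case: (ltngtP i j) => // ij; [|move/esym]; move/wlog_lt: ij.
have us : uniq s.
  rewrite map_inj_uniq ?iota_uniq // => i j /mulgI/mulIg; exact: inj.
have sub : {subset s <= word_ball r}.
  move=> _ /mapP[j jN ->]; apply: mem_word_ball; apply: near.
  by move: jN; rewrite mem_iota; lia.
by have := uniq_leq_size us sub; rewrite size_word_ball size_map size_iota; lia.
Qed.

End Ball.

(** * Geodesics in the realized Cayley graph, and passage to slim discrete triangles *)

Section CayleyGeodesic.
Variables (R : realType) (G : groupType) (S : {fset G}).
Hypothesis genS : generates S.
Local Notation dist := (word_dist S).
Local Notation lo := (@Num.trunc R).
Implicit Types (p q : cayley_graph R S) (f : nat -> G) (s t : R).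

Lemma cayley_point_eq p q :
  cp_src p = cp_src q -> cp_tgt p = cp_tgt q -> cp_pos p = cp_pos q -> p = q.
Proof.
case: p q => [x y s e h] [x' y' s' e' h'] /= ex ey es.
by rewrite ex ey es in e h *; rewrite (eq_irrelevance e e') (eq_irrelevance h h').
Qed.

Lemma cp_lenE p : cp_len p = (dist (cp_src p) (cp_tgt p))%:R.
Proof. by []. Qed.

Lemma cp_to_end_ge0 b p : 0 <= cp_to_end b p.
Proof.
by rewrite /cp_to_end mulr_ge0 ?ler0n //; have := cp_pos01 p; case: b; lra.
Qed.

Lemma dist_viaC b b' p q : dist_via b b' p q = dist_via b' b q p.
Proof.
rewrite /dist_via -!/(dist _ _) (word_distC genS (cp_end b p)).
by rewrite addrC addrA addrAC.
Qed.

Lemma cayley_distC p q : cayley_dist p q = cayley_dist q p.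
Proof.
rewrite /cayley_dist !cp_lenE (eq_sym (cp_src q)) (eq_sym (cp_tgt q)).
case: ifP => [/andP[/eqP-> /eqP->]|_]; first by rewrite distrC.
rewrite (eq_sym (cp_src q)) (eq_sym (cp_tgt q)) andbC.
case: ifP => [/andP[/eqP-> /eqP->]|_].
  rewrite (word_distC genS); congr (_ * _).
  by congr `|_|; ring.
rewrite !(dist_viaC _ _ p q) -!minA; congr (Num.min _ _).
by rewrite !minA; congr (Num.min _ _); rewrite minC.
Qed.

(** A path from a vertex enters the edge of [q] through an end, and the nearer end works for all
    four routes. This replaces points inside edges by group elements at no cost. *)
Lemma cayley_dist_vertex_ge x p q : cp_src p = x -> cp_tgt p = x ->
  exists b, (dist x (cp_end b q))%:R <= cayley_dist p q.
Proof.
move=> sp tp; rewrite /cayley_dist.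
have pos0 r : cp_len p = 0 -> `|r| * cp_len p = 0 by move=> ->; rewrite mulr0.
have len0 : cp_len p = 0 by rewrite cp_lenE sp tp word_distxx.
case: ifP => [/andP[/eqP sq _]|_].
  by exists false; rewrite pos0 //= -sq sp word_distxx.
case: ifP => [/andP[/eqP sq _]|_].
  by exists true; rewrite pos0 //= -sq sp word_distxx.
have via b b' : (dist x (cp_end b' q))%:R <= dist_via b b' p q.
  rewrite /dist_via (_ : cp_end b p = x) -/(dist _ _); last by case: b.
  by have := cp_to_end_ge0 b p; have := cp_to_end_ge0 b' q; lra.
case: (leqP (dist x (cp_end false q)) (dist x (cp_end true q))) => le.
  exists false; rewrite !le_min !via /=.
  by rewrite !(le_trans _ (via _ true)) ?ler_nat.
exists true; rewrite !le_min !via /=.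
by rewrite !(le_trans _ (via _ false)) ?ler_nat // ltnW.
Qed.

(** At an integer time the carrying edge is degenerate, so the point depends only on the vertex and
    not on the path through it. *)
Definition ceiln s : nat := if s == (lo s)%:R then lo s else (lo s).+1.

Lemma truncn_le_self s : 0 <= s -> (lo s)%:R <= s.
Proof. by rewrite truncn_le. Qed.

Lemma truncn_ceilnP s : 0 <= s ->
  ceiln s = lo s /\ s = (lo s)%:R \/ ceiln s = (lo s).+1 /\ (lo s)%:R < s < (ceiln s)%:R.
Proof.
move=> s0; rewrite /ceiln; case: eqVneq => [e|ne]; [by left|right; split => //].
by rewrite lt_neqAle eq_sym ne truncn_le_self ?truncnS_gt.
Qed.

Lemma ceiln_le s (n : nat) : 0 <= s <= n%:R -> (ceiln s <= n)%N.
Proof.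
case/andP=> s0 sn; case: (truncn_ceilnP s0) => -[-> ].
  by move=> es; rewrite -(ler_nat R) -es.
by case/andP=> ls _; rewrite -(ltr_nat R) (lt_le_trans ls).
Qed.

Section PathPoint.
Variables (f : nat -> G).
Hypothesis f1 : forall i, (dist (f i) (f i.+1) <= 1)%N.

(** The default for negative [s] makes [path_point] total on [R], as [geodesic_segment] demands of
    its parametrization. *)
Definition path_pos s : R := if 0 <= s then s - (lo s)%:R else 0.

Lemma path_edge s : (word_length S ((f (lo s))^-1 * f (ceiln s))%g <= 1)%N.
Proof. by rewrite -/(dist _ _) /ceiln; case: ifP; rewrite ?word_distxx. Qed.

Lemma path_pos01 s : 0 <= path_pos s <= 1.
Proof.
rewrite /path_pos; case: ifP => [s0|_]; last by rewrite lexx ler01.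
have := truncnS_gt s; rewrite -natr1.
by have := truncn_le_self s0; lra.
Qed.

Definition path_point s : cayley_graph R S :=
  CayleyPoint (path_edge s) (path_pos01 s).

Variable n : nat.
Hypothesis gf : geodesic_path S f n.

Lemma path_point_len s : 0 <= s <= n%:R ->
  cp_len (path_point s) = (ceiln s)%:R - (lo s)%:R.
Proof.
move=> sn; have s0 : 0 <= s by case/andP: sn.
have le : (lo s <= ceiln s)%N by rewrite /ceiln; case: ifP.
by rewrite cp_lenE /= gf.2 ?natrB // le ceiln_le.
Qed.

Lemma path_point_to_end b s : 0 <= s <= n%:R ->
  cp_to_end b (path_point s) = if b then (ceiln s)%:R - s else s - (lo s)%:R.
Proof.
move=> sn; have s0 : 0 <= s by case/andP: sn.
rewrite /cp_to_end path_point_len //= /path_pos s0.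
have [[-> es]|[-> _]] := truncn_ceilnP s0.
  by rewrite -es subrr mulr0; case: b.
by rewrite -natr1; case: b; ring.
Qed.

Lemma geodesic_path_inj i j : (i <= n)%N -> (j <= n)%N -> f i = f j -> i = j.
Proof.
move=> iN jN e; have := gf.2 i j; have := gf.2 j i.
by rewrite e word_distxx; case: (leqP i j); lia.
Qed.

Lemma cayley_dist_path_point s t : 0 <= s <= n%:R -> 0 <= t <= n%:R ->
  cayley_dist (path_point s) (path_point t) = `|s - t|.
Proof.
wlog st : s t / s <= t => [wl|] sn tn.
  case: (leP s t) => [st|/ltW ts]; first exact: wl.
  by rewrite cayley_distC wl // distrC.
have s0 : 0 <= s by case/andP: sn.
have t0 : 0 <= t by case/andP: tn.
have hs := ceiln_le sn; have ht := ceiln_le tn.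
have lhs : (lo s <= ceiln s)%N by rewrite /ceiln; case: ifP.
have lht : (lo t <= ceiln t)%N by rewrite /ceiln; case: ifP.
have lst : (lo s <= lo t)%N by exact: le_truncn.
rewrite ler0_norm ?subr_le0 // opprB /cayley_dist.
case: ifP => [/andP[/eqP /= el /eqP /= eh]|ne1].
  have {}el : lo s = lo t by apply: geodesic_path_inj el; lia.
  have {}eh : ceiln s = ceiln t by apply: geodesic_path_inj eh; lia.
  rewrite path_point_len //= /path_pos s0 t0 el.
  have [[e1 e2]|[e1 _]] := truncn_ceilnP s0; have [[e3 e4]|[e3 _]] := truncn_ceilnP t0; try lia.
    by rewrite e1 el subrr mulr0 [in RHS]e2 e4 el subrr.
  rewrite e1 el -natr1 ler0_norm; last by lra.
  by ring.
(* A geodesic does not run back along an edge: this case collapses to a single vertex, already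
   covered. *)
case: ifP => [/andP[/eqP /= el /eqP /= eh]|_].
  have {}el : lo s = ceiln t by apply: geodesic_path_inj el; lia.
  have {}eh : ceiln s = lo t by apply: geodesic_path_inj eh; lia.
  have [e1 e2] : lo s = lo t /\ ceiln s = ceiln t by lia.
  by rewrite /= e1 e2 !eqxx in ne1.
(* Edges are traversed in order, so distinct carrying edges put the end of the first no later than
   the start of the second. *)
have hl : (ceiln s <= lo t)%N.
  rewrite leqNgt; apply/negP => lt.
  have [[e1 e2]|[e1 /andP[e2 e2']]] := truncn_ceilnP s0; first lia.
  have el : lo s = lo t by lia.
  have [[e3 e4]|[e3 _]] := truncn_ceilnP t0.
    by move: e2; rewrite el -e4 ltNge st.
  by rewrite /= e1 e3 el !eqxx in ne1.
rewrite /dist_via !path_point_to_end //= -!/(dist _ _) !gf.2; try lia.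
rewrite !natrB; try lia.
have ls := truncn_le_self s0; have lt := truncn_le_self t0.
have sh : s <= (ceiln s)%:R by case: (truncn_ceilnP s0) => -[-> ]; [move=> <-|case/andP => _ /ltW].
have th : t <= (ceiln t)%:R by case: (truncn_ceilnP t0) => -[-> ]; [move=> <-|case/andP => _ /ltW].
move: hl; rewrite -(ler_nat R) => hl.
(* The shortest route leaves by the target of the first edge and enters by the source of the
   second. *)
rewrite (min_l (x := (ceiln s)%:R - s + _ + _)); last by lra.
rewrite (min_r (y := (ceiln s)%:R - s + _ + _)); first by ring.
by rewrite le_min; apply/andP; split; lra.
Qed.

Lemma path_point_nat (k : nat) :
  [/\ cp_src (path_point k%:R) = f k, cp_tgt (path_point k%:R) = f k
    & cp_pos (path_point k%:R) = 0].
Proof. by rewrite /= /ceiln /path_pos natrK eqxx ler0n subrr. Qed.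

Lemma path_geodesic_segment :
  geodesic_segment (@cayley_dist R G S) (path_point 0) (path_point n%:R)
    [set path_point s | s in [set s : R | 0 <= s <= n%:R]].
Proof.
exists n%:R, path_point; split => //.
exact: cayley_dist_path_point.
Qed.

Lemma path_point_end b s : 0 <= s <= n%:R ->
  (dist (f 0%N) (cp_end b (path_point s)) + dist (cp_end b (path_point s)) (f n)
   = dist (f 0%N) (f n))%N.
Proof.
move=> sn.
have [k kn ->] : exists2 k, (k <= n)%N & cp_end b (path_point s) = f k.
  have := ceiln_le sn; have : (lo s <= ceiln s)%N by rewrite /ceiln; case: ifP.
  by case: b => /= *; [exists (ceiln s)|exists (lo s)] => //; lia.
by rewrite !gf.2; lia.
Qed.

End PathPoint.

(** Needed to close triangles: [delta_hyperbolic] wants consecutive sides to share an end as equal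
    terms, not merely at distance 0. *)
Lemma path_point_nat_eq f f' h h' (k k' : nat) : f k = f' k' ->
  @path_point f h k%:R = @path_point f' h' k'%:R.
Proof.
move=> e; have [s1 t1 p1] := path_point_nat h k; have [s2 t2 p2] := path_point_nat h' k'.
by apply: cayley_point_eq; rewrite ?s1 ?s2 ?t1 ?t2 ?p1 ?p2.
Qed.

(** Slimness is applied at the vertex [f k] of a triangle whose sides are realized discrete
    geodesics; the nearby point is then moved to an end of its edge, which is still on the side. *)
Lemma cayley_hyperbolic_slim_paths (delta : R) (d : nat) :
  cayley_hyperbolic S delta -> delta <= d%:R -> slim_paths S d.
Proof.
move=> hyp dd f n z k gf kn.
have [f1 [f10 f1n gf1]] := exists_geodesic_path genS (f n) z.
have [f2 [f20 f2n gf2]] := exists_geodesic_path genS z (f 0%N).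
have segA := path_geodesic_segment gf.1 gf.
have segB := path_geodesic_segment gf1.1 gf1.
have segC := path_geodesic_segment gf2.1 gf2.
rewrite (_ : path_point gf1.1 0 = path_point gf.1 n%:R) in segB; last first.
  exact: (@path_point_nat_eq _ _ _ _ 0%N).
rewrite -(_ : path_point gf1.1 (dist (f n) z)%:R = path_point gf2.1 0) in segC; last first.
  by apply: (@path_point_nat_eq _ _ _ _ _ 0%N); rewrite f1n.
rewrite (_ : path_point gf2.1 (dist z (f 0%N))%:R = path_point gf.1 0) in segC; last first.
  by apply: (@path_point_nat_eq _ _ _ _ _ 0%N); rewrite f2n.
have [sub _ _] := hyp _ _ _ _ _ _ segA segB segC.
have [] := sub (path_point gf.1 k%:R); first by exists k%:R => //=; rewrite ler0n ler_nat.
have [sk tk _] := path_point_nat gf.1 k.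
have close q : cayley_dist (path_point gf.1 k%:R) q <= delta ->
    exists b, (dist (f k) (cp_end b q) <= d)%N.
  move=> le; have [b leb] := cayley_dist_vertex_ge q sk tk.
  by exists b; rewrite -(ler_nat R) (le_trans leb) // (le_trans le).
move=> _ [[s sn <-]|[s sn <-]] /close[b leb].
- right; exists (cp_end b (path_point gf1.1 s)) => //.
  have := path_point_end gf1.1 gf1 b sn; rewrite f10 f1n.
  by rewrite !(word_distC genS z) (word_distC genS (f n)) addnC.
- left; exists (cp_end b (path_point gf2.1 s)) => //.
  have := path_point_end gf2.1 gf2 b sn; rewrite f20 f2n.
  by rewrite !(word_distC genS (f 0%N)) (word_distC genS z) addnC.
Qed.

End CayleyGeodesic.

(** * Fekete's lemma *)

Section Subadditive.
Variables (R : realType) (u : nat -> R).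
Hypothesis u_ge0 : forall n, 0 <= u n.
Hypothesis u_sub : forall m n, u (m + n)%N <= u m + u n.

(** Divide [n] by [k]; the remainder contributes at most a constant independent of [n]. *)
Lemma subadditive_le (k n : nat) : (0 < k)%N ->
  u n <= n%:R * (u k / k%:R) + (u 0%N + k%:R * u 1%N).
Proof.
move=> k0; have k0R : 0 < k%:R :> R by rewrite ltr0n.
have mul q r : u (q * k + r)%N <= q%:R * u k + u r.
  elim: q => [|q IHq]; first by rewrite mul0r add0r.
  by rewrite mulSn -addnA (le_trans (u_sub _ _)) // -natr1 mulrDl; lra.
have lin r : u r <= u 0%N + r%:R * u 1%N.
  elim: r => [|r IHr]; first by rewrite mul0r addr0.
  by rewrite -addn1 (le_trans (u_sub _ _)) // natrD mulrDl; lra.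
rewrite {1}(divn_eq n k) (le_trans (mul _ _)) // lerD //.
  have -> : (n %/ k)%:R * u k = ((n %/ k)%:R * k%:R) * (u k / k%:R) :> R.
    by field; rewrite gt_eqF.
  by rewrite ler_wpM2r ?divr_ge0 // -natrM ler_nat leq_trunc_div.
rewrite (le_trans (lin _)) // lerD2l ler_wpM2r // ler_nat ltnW //.
exact: ltn_pmod.
Qed.

Lemma subadditive_is_cvg : cvgn (fun n => u n / n%:R).
Proof.
(* The limit will be the infimum of [A]. Index 0 is left out, since division by zero would put 0
   into [A]. *)
pose A : set R := [set u n / n%:R | n in [set n | (0 < n)%N]]%classic.
have infA : has_inf A.
  split; first by exists (u 1%N / 1%:R); exists 1%N.
  by exists 0 => _ [n _ <-]; rewrite divr_ge0.
apply/cvg_ex; exists (inf A); apply/cvgrPdist_le => eps eps0.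
have eps2 : 0 < eps / 2 by lra.
have [_ [k /= k0 <-] ltk] := inf_adherent eps2 infA.
pose C := u 0%N + k%:R * u 1%N.
near=> n.
have n0 : (0 < n)%N by near: n; exact: nbhs_infty_gt.
have n0R : 0 < n%:R :> R by rewrite ltr0n.
have Cn : C / (eps / 2) <= n%:R by near: n; exact: nbhs_infty_ger.
have lo : inf A <= u n / n%:R by apply: ge_inf; [exact: infA.2|exists n].
have up : u n / n%:R <= u k / k%:R + eps / 2.
  rewrite ler_pdivrMr // (le_trans (subadditive_le n k0)) // mulrDl mulrC lerD2l.
  by rewrite [leRHS]mulrC -ler_pdivrMr.
by rewrite distrC ger0_norm; lra.
Unshelve. all: by end_near.
Qed.

End Subadditive.

(** * Lower bound for the stable norm *)

Section StableNorm.
Variables (R : realType) (G : groupType) (S : {fset G}).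
Hypothesis genS : generates S.

Lemma stable_norm_ge (g : G) (k : nat) : (0 < k)%N ->
  (forall n, n <= k * word_length S (g ^+ n)%g)%N -> k%:R^-1 <= stable_norm R S g.
Proof.
move=> k0 le; rewrite /stable_norm; apply: limr_ge.
  apply: (@subadditive_is_cvg R (fun n => (word_length S (g ^+ n)%g)%:R)) => // m n.
  by rewrite expgnDr -natrD ler_nat word_lengthM.
near=> n.
have n0 : 0 < n%:R :> R by rewrite ltr0n; near: n; exact: nbhs_infty_gt.
by rewrite ler_pdivlMr // mulrC ler_pdivrMr ?ltr0n // mulrC -natrM ler_nat.
Unshelve. all: by end_near.
Qed.

Lemma four_point_stable_norm_ge (e : nat) (g : G) :
  four_point S e -> infinite_order g ->
  ((#|` S|%fset).*2.+1 ^ (4 * e + 2))%:R^-1 <= stable_norm R S g.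
Proof.
move=> hyp inf_g; set N := (_ ^ _)%N.
have [[k kN fast]|slow] := pselect (exists2 k, (k <= N)%N &
    (word_length S (g ^+ k)%g + e < word_length S (g ^+ k.*2)%g)%N); last first.
  have [|c near] := quasi_fixed_point genS hyp (g := g) (N := N).
    by move=> k kN; rewrite leqNgt; apply/negP => fast; apply: slow; exists k.
  by case: (quasi_fixed_point_torsion genS (leqnn N) near inf_g).
have k0 : (0 < k)%N.
  by rewrite lt0n; apply: contraTneq fast => ->; rewrite expg0 word_length1.
apply: (@le_trans _ _ k%:R^-1); first by rewrite lef_pV2 ?posrE ?ltr0n ?ler_nat // (leq_trans k0).
apply: stable_norm_ge => // n.
rewrite -muln2 expgnA in fast.
(* [n <= |(g^k)^n| = |(g^n)^k| <= k |g^n|]. *)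
rewrite (leq_trans (word_length_exp_ge genS hyp n fast)) //.
by rewrite expgnAC word_length_exp.
Qed.

End StableNorm.

(** * Computability of the constant *)

Section Recursive.
Local Open Scope nat_scope.

Lemma recursive_comp1 n (f : nat -> nat) (g : n.-tuple nat -> nat) :
  recursive (fun v : 1.-tuple nat => f (thead v)) -> recursive g ->
  recursive (fun v => f (g v)).
Proof.
move=> rf rg; have := rec_comp rf (fun _ : 'I_1 => rg).
by congr recursive; apply/funext => v; rewrite /thead tnth_mktuple.
Qed.

Lemma recursive_comp2 n (f : nat -> nat -> nat) (g1 g2 : n.-tuple nat -> nat) :
  recursive2 f -> recursive g1 -> recursive g2 ->
  recursive (fun v => f (g1 v) (g2 v)).
Proof.
move=> rf r1 r2.
have rg (i : 'I_2) : recursive (if i == ord0 then g1 else g2) by case: ifP.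
have := rec_comp rf rg.
by congr recursive; apply/funext => v; rewrite !tnth_mktuple.
Qed.

Lemma recursive_const n c : recursive (fun _ : n.-tuple nat => c).
Proof.
elim: c => [|c IHc]; first exact: rec_zero.
exact: recursive_comp1 rec_succ IHc.
Qed.

(** Primitive recursion whose step ignores the counter; sum, product and power are successive
    instances. *)
Lemma recursive2_iter (f : nat -> nat) (op h : nat -> nat -> nat) :
  recursive (fun v : 1.-tuple nat => f (thead v)) -> recursive2 op ->
  (forall y, h 0 y = f y) -> (forall k y, h k.+1 y = op y (h k y)) ->
  recursive2 h.
Proof.
move=> rf rop h0 hS.
(* The step receives the triple of counter, previous value and parameter; [op] takes the last, then
   the middle one. *)
have rg := recursive_comp2 rop (rec_proj (ord_max : 'I_3)) (rec_proj (inord 1 : 'I_3)).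
apply: (rec_prec rf rg) => [v|k v].
  by rewrite /thead !(tnth_nth 0) /= h0.
by rewrite !(tnth_nth 0) /= inordK //= hS.
Qed.

Lemma recursive2_addn : recursive2 addn.
Proof.
apply: (@recursive2_iter id (fun _ x => x.+1)) => //; first exact: rec_proj.
exact: recursive_comp1 rec_succ (rec_proj _).
Qed.

Lemma recursive2_muln : recursive2 muln.
Proof.
apply: (@recursive2_iter (fun=> 0) addn) => //; first exact: rec_zero.
exact: recursive2_addn.
Qed.

Lemma recursive2_expn : recursive2 (fun k y => y ^ k).
Proof.
apply: (@recursive2_iter (fun=> 1) muln) => //; first exact: recursive_const.
  exact: recursive2_muln.
by move=> k y; rewrite expnS.
Qed.

End Recursive.

(** The size of [word_ball] for [m] generators and radius [4 * e + 2], where [e = 4 * d.+1]. *)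
Definition stable_norm_denominator (m d : nat) : nat :=
  (m.*2.+1 ^ (4 * (4 * d.+1) + 2))%N.

Lemma recursive2_stable_norm_denominator : recursive2 stable_norm_denominator.
Proof.
have rS (g : 2.-tuple nat -> nat) : recursive g -> recursive (fun v => (g v).+1).
  exact: recursive_comp1 rec_succ.
have rM c g : recursive g -> recursive (fun v : 2.-tuple nat => c * g v)%N.
  exact: recursive_comp2 recursive2_muln (recursive_const _ c).
have rbase := rS _ (rM 2 _ (rec_proj (ord0 : 'I_2))).
have rexp := rM 4 _ (rM 4 _ (rS _ (rec_proj (ord_max : 'I_2)))).
have := recursive_comp2 recursive2_expn (rS _ (rS _ rexp)) rbase.
congr recursive; apply/funext => v.
by rewrite /stable_norm_denominator addn2 mul2n.
Qed.

Lemma computable_rat2_invn (N : nat -> nat -> nat) :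
  (forall m n, 0 < N m n)%N -> recursive2 N ->
  computable_rat2 (fun m n => (N m n)%:R^-1).
Proof.
move=> N0 rN.
(* The fraction [1 / N] is already reduced; positivity of [N] excludes the convention that the
   inverse of 0 is 0. *)
have nd m n : numq (N m n)%:R^-1 = 1 /\ denq (N m n)%:R^-1 = N m n.
  have cop : coprime `|1%Z| `|Posz (N m n)| by rewrite coprime1n.
  have := coprimeq_num cop; have := coprimeq_den cop.
  rewrite div1r !pmulrn => -> ->; have := N0 m n.
  by case: (N m n) => // k _; rewrite gtr0_sgz.
split; rewrite /recursive2.
- rewrite (_ : (fun _ => _) = fun=> 0%N); first exact: rec_zero.
  by apply/funext => v; rewrite invr_lt0 ltrn0.
- rewrite (_ : (fun _ => _) = fun=> 1%N); first exact: recursive_const.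
  by apply/funext => v; rewrite (nd _ _).1.
- rewrite (_ : (fun _ => _) = fun v : 2.-tuple nat => N (tnth v ord0) (tnth v ord_max)) //.
  by apply/funext => v; rewrite (nd _ _).2.
Qed.

(* K is one algorithm for all groups: it computes the constant from the number
   of generators and an integer upper bound of the hyperbolicity constant. *)
Theorem theorem1 (R : realType) :
  exists2 K : nat -> nat -> rat, computable_rat2 K &
    forall (G : groupType) (S : {fset G}) (delta : R) (d : nat),
      generates S ->
      0 <= delta -> cayley_hyperbolic S delta -> delta <= d%:R ->
      0 < K #|` S|%fset d /\
      forall g : G, infinite_order g ->
        ratr (K #|` S|%fset d) <= stable_norm R S g.
Proof.
have N0 m n : (0 < stable_norm_denominator m n)%N by rewrite expn_gt0.
exists (fun m n => (stable_norm_denominator m n)%:R^-1).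
  exact: computable_rat2_invn N0 recursive2_stable_norm_denominator.
move=> G S delta d genS _ hyp dd; split; first by rewrite invr_gt0 ltr0n.
move=> g inf_g; rewrite fmorphV /= ratr_nat; apply: four_point_stable_norm_ge => //.
exact/slim_paths_four_point/(cayley_hyperbolic_slim_paths genS hyp dd).
Qed.
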